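(* Let $n\ge 1$ and $\sigma_1\ge\dots\ge\sigma_{n-1}\ge 1$, and let $\phi$ be the Lorentzian inner product on the Heisenberg Lie algebra $\mathfrak{h}_{2n+1}$ represented in the basis $\{f_1,g_1,\dots,f_n,g_n,z\}$ by the block diagonal matrix with blocks $\operatorname{diag}\{\sigma_1,\sigma_1,\dots,\sigma_{n-1},\sigma_{n-1}\}$ and $\begin{bmatrix}1&0&0\\0&0&1\\0&1&0\end{bmatrix}$. Let $\mathscr{B}=\{v_1,\dots,v_{2n+1}\}$ be the orthonormal basis given by $v_{2k-1}=\frac{1}{\sqrt{\sigma_k}}f_k$, $v_{2k}=\frac{1}{\sqrt{\sigma_k}}g_k$ for $1\le k\le n-1$, $v_{2n-1}=f_n$, $v_{2n}=\frac{1}{\sqrt2}(g_n+z)$, $v_{2n+1}=\frac{1}{\sqrt2}(g_n-z)$. Then the Levi-Civita connection $\nabla$ of $(\mathfrak{h}_{2n+1},\phi)$ satisfies $$\nabla_{v_i}v_i=0\quad(i=1,\dots,2n-1),\qquad \nabla_{v_{2n}}v_{2n}=\nabla_{v_{2n+1}}v_{2n+1}=\frac12v_{2n-1};$$ for every $k=1,\dots,n-1$, $$\nabla_{v_{2k-1}}v_{2k}=-\nabla_{v_{2k}}v_{2k-1}=\frac{1}{2\sqrt2\,\sigma_k}v_{2n}-\frac{1}{2\sqrt2\,\sigma_k}v_{2n+1},$$ $$\nabla_{v_{2k-1}}v_{2n}=\nabla_{v_{2n}}v_{2k-1}=\frac{-1}{2\sqrt2\,\sigma_k}v_{2k},\qquad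 \nabla_{v_{2k}}v_{2n}=\nabla_{v_{2n}}v_{2k}=\frac{1}{2\sqrt2\,\sigma_k}v_{2k-1},$$ $$\nabla_{v_{2k-1}}v_{2n+1}=\nabla_{v_{2n+1}}v_{2k-1}=\frac{-1}{2\sqrt2\,\sigma_k}v_{2k},\qquad \nabla_{v_{2k}}v_{2n+1}=\nabla_{v_{2n+1}}v_{2k}=\frac{1}{2\sqrt2\,\sigma_k}v_{2k-1};$$ $$\nabla_{v_{2n-1}}v_{2n}=\nabla_{v_{2n-1}}v_{2n+1}=0,\qquad \nabla_{v_{2n}}v_{2n-1}=\nabla_{v_{2n+1}}v_{2n-1}=\frac{-1}{2}v_{2n}+\frac12v_{2n+1},$$ $$\nabla_{v_{2n}}v_{2n+1}=\nabla_{v_{2n+1}}v_{2n}=\frac12v_{2n-1};$$ and all the other terms $\nabla_{v_a}v_b$ are zero.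
   Context: The Heisenberg Lie algebra $\mathfrak{h}_{2n+1}$ is the real Lie algebra with basis $\{f_1,g_1,\dots,f_n,g_n,z\}$ whose only nonzero brackets of basis elements (up to antisymmetry) are $[f_i,g_i]=z$, $i=1,\dots,n$. For $n=1$ there are no $\sigma_k$. A Lorentzian inner product is a nondegenerate symmetric bilinear form of signature $(2n,1)$; an orthonormal basis $\{v_1,\dots,v_m\}$ satisfies $\langle v_i,v_j\rangle=0$ for $i\ne j$, $\langle v_i,v_i\rangle=1$ for $i<m$, and $\langle v_m,v_m\rangle=-1$. The Levi-Civita connection of $(\mathfrak{g},\langle\cdot,\cdot\rangle)$ is the bilinear map $(u,v)\mapsto\nabla_uv$ on $\mathfrak{g}$ determined by the Koszul formula $2\langle\nabla_uv,w\rangle=\langle[u,v],w\rangle+\langle[w,u],v\rangle+\langle[w,v],u\rangle$ for all $u,v,w\in\mathfrak{g}$. *)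

(* Defs.v *)
From HB Require Import structures.
From mathcomp Require Import all_boot all_order all_algebra.
From mathcomp Require Export sesquilinear.
From mathcomp Require Import reals ring lra zify.

Set Implicit Arguments.
Unset Strict Implicit.
Unset Printing Implicit Defensive.

Import Order.TTheory GRing.Theory Num.Theory.
Local Open Scope ring_scope.

Definition is_lie_bracket (R : nzRingType) (V : lmodType R)
    (br : V -> V -> V) : Prop :=
  [/\ bilinear_for *:%R *:%R br,
      forall u, br u u = 0
    & forall u v w, br u (br v w) + br v (br w u) + br w (br u v) = 0].

Definition is_levi_civita (R : nzRingType) (V : lmodType R)
    (br : V -> V -> V) (phi : V -> V -> R) (nabla : V -> V -> V) : Prop :=
  bilinear_for *:%R *:%R nabla /\
  forall u v w, 2 * phi (nabla u v) w
                = phi (br u v) w + phi (br w u) v + phi (br w v) u.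

(* The elements of h_{2n+1} are the coordinate rows in the basis              *)
(* f_1, g_1, ..., f_n, g_n, z. Coordinates are numbered from 0, whereas the   *)
(* families f, g, sigma and v are numbered from 1, so f_k is the coordinate   *)
(* vector number 2(k-1) and g_k is number 2k-1.                               *)
Notation heis R n := 'rV[R]_(n.*2.+1).

Definition heis_e (R : realType) (n j : nat) : heis R n :=
  \row_i ((i : nat) == j)%:R.

Definition heis_f (R : realType) (n k : nat) : heis R n :=
  heis_e R n k.-1.*2.

Definition heis_g (R : realType) (n k : nat) : heis R n :=
  heis_e R n k.-1.*2.+1.

Definition heis_z (R : realType) (n : nat) : heis R n := heis_e R n n.*2.

Definition heis_bracket (R : realType) (n : nat) (u v : heis R n) : heis R n :=
  (\sum_(k < n) (u 0 (inord k.*2) * v 0 (inord k.*2.+1)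
                 - u 0 (inord k.*2.+1) * v 0 (inord k.*2))) *: heis_z R n.

Definition heis_block (R : realType) : 'M[R]_3 :=
  \matrix_(i, j) nth 0 (nth [::] [:: [:: 1; 0; 0];
                                     [:: 0; 0; 1];
                                     [:: 0; 1; 0]] i) j.

(* [conform_mx 0] is only a cast: 2(n-1) + 3 = 2n + 1 for n >= 1, but not by  *)
(* conversion. The diagonal is sigma_1, sigma_1, ..., sigma_{n-1},            *)
(* sigma_{n-1}.                                                               *)
Definition heis_gram (R : realType) (n : nat) (sigma : nat -> R) :
    'M[R]_(n.*2.+1) :=
  conform_mx 0
    (block_mx (diag_mx (\row_(j < n.-1.*2) sigma j./2.+1)) 0
              0 (heis_block R)).

Definition heis_phi (R : realType) (n : nat) (sigma : nat -> R)
    (u v : heis R n) : R :=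
  (u *m heis_gram n sigma *m v^T) 0 0.

(* In the last two cases, i is 2k-1 or 2k for k = i.+1./2. *)
Definition heis_v (R : realType) (n : nat) (sigma : nat -> R) (i : nat) :
    heis R n :=
  if i == n.*2.+1 then (1 / Num.sqrt 2) *: (heis_g R n n - heis_z R n)
  else if i == n.*2 then (1 / Num.sqrt 2) *: (heis_g R n n + heis_z R n)
  else if i == n.*2.-1 then heis_f R n n
  else if odd i then (1 / Num.sqrt (sigma i.+1./2)) *: heis_f R n i.+1./2
  else (1 / Num.sqrt (sigma i.+1./2)) *: heis_g R n i.+1./2.

(* The pairs (a, b) for which the value of nabla_{v_a} v_b is listed.         *)
Definition listed_pairs (n : nat) : seq (nat * nat) :=
  [seq (i, i) | i <- iota 1 n.*2.+1]
  ++ flatten [seq [:: (k.*2.-1, k.*2);    (k.*2, k.*2.-1);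
                      (k.*2.-1, n.*2);    (n.*2, k.*2.-1);
                      (k.*2, n.*2);       (n.*2, k.*2);
                      (k.*2.-1, n.*2.+1); (n.*2.+1, k.*2.-1);
                      (k.*2, n.*2.+1);    (n.*2.+1, k.*2)]
             | k <- iota 1 n.-1]
  ++ [:: (n.*2.-1, n.*2); (n.*2.-1, n.*2.+1);
         (n.*2, n.*2.-1); (n.*2.+1, n.*2.-1);
         (n.*2, n.*2.+1); (n.*2.+1, n.*2)].

Section Basis.
Context (R : realType) (n : nat).
Implicit Types k l : nat.
Implicit Types u v w : heis R n.

Let f k := heis_f R n k.
Let g k := heis_g R n k.
Let z := heis_z R n.

Lemma heis_eE a (i : nat) : (i < n.*2.+1)%N ->
  heis_e R n a 0 (inord i) = (i == a)%:R.
Proof. by move=> lt_i; rewrite mxE inordK. Qed.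

Lemma heis_bracket_e a b : heis_bracket (heis_e R n a) (heis_e R n b)
  = (\sum_(k < n) (((k.*2 == a) && (k.*2.+1 == b))%:R
                   - ((k.*2.+1 == a) && (k.*2 == b))%:R)) *: z.
Proof.
rewrite /heis_bracket; congr (_ *: _); apply: eq_bigr => k _.
have k_lt := ltn_ord k.
have lt1 : (k.*2 < n.*2.+1)%N by rewrite ltnS leq_double ltnW.
have lt2 : (k.*2.+1 < n.*2.+1)%N by rewrite ltnS ltn_double.
by rewrite !heis_eE // -!natrM !mulnb.
Qed.

Lemma heis_bracket_fg k l : (0 < k <= n)%N -> (0 < l <= n)%N ->
  heis_bracket (f k) (g l) = if k == l then z else 0.
Proof.
case: k l => // k [] // l /= k_lt l_lt; rewrite heis_bracket_e eqSS /=.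
rewrite (bigD1 (Ordinal k_lt)) //= eqSS !(inj_eq double_inj) eqxx /=.
rewrite big1 => [|i ne_i].
  have -> /= : (k.*2.+1 == k.*2) = false by rewrite gtn_eqF.
  rewrite addr0 subr0.
  by case: eqP => _; rewrite ?scale1r ?scale0r.
rewrite -val_eqE /= in ne_i; rewrite (inj_eq double_inj) (negPf ne_i) /=.
have -> // : (i.*2.+1 == k.*2) = false.
  by apply/eqP => /(congr1 odd); rewrite /= !odd_double.
by rewrite subrr.
Qed.

Lemma heis_bracket_ff k l : heis_bracket (f k) (f l) = 0.
Proof.
rewrite heis_bracket_e big1 ?scale0r // => i _.
have ne a : (i.*2.+1 == a.*2) = false.
  by apply/eqP => /(congr1 odd); rewrite /= !odd_double.
by rewrite !ne andbF subrr.
Qed.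

Lemma heis_bracket_gg k l : heis_bracket (g k) (g l) = 0.
Proof.
rewrite heis_bracket_e big1 ?scale0r // => i _.
have ne a : (i.*2 == a.*2.+1) = false.
  by apply/eqP => /(congr1 odd); rewrite /= !odd_double.
by rewrite !ne andbF subrr.
Qed.


Lemma heis_bracket_z u a : heis_bracket u (a *: z) = 0.
Proof.
rewrite /heis_bracket big1 ?scale0r // => k _; have k_lt := ltn_ord k.
have lt1 : (k.*2 < n.*2)%N by rewrite ltn_double.
have lt2 : (k.*2.+1 < n.*2)%N by rewrite ltn_Sdouble.
rewrite ![(a *: z) _ _]mxE !heis_eE ?ltnS ?(ltnW lt1) ?(ltnW lt2) //.
by rewrite (ltn_eqF lt1) (ltn_eqF lt2) !mulr0 subrr.
Qed.

Lemma heis_bracket_lie : is_lie_bracket (@heis_bracket R n).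
Proof.
split.
- split=> w a u v; rewrite /= /heis_bracket scalerA -scalerDl; congr (_ *: _);
    rewrite mulr_sumr -big_split; apply: eq_bigr => k _; rewrite !mxE /=; ring.
- move=> u; rewrite /heis_bracket big1 ?scale0r // => k _.
  by rewrite mulrC subrr.
- by move=> u v w; rewrite !heis_bracket_z !addr0.
Qed.

Context (sigma : nat -> R) (n_gt0 : (0 < n)%N).

Local Notation phi := (@heis_phi R n sigma).
Local Notation v := (heis_v n sigma).

Let gram_entry (i j : nat) : R :=
  if (i < n.-1.*2)%N then if i == j then sigma i./2.+1 else 0
  else if (j < n.-1.*2)%N then 0
  else nth 0 (nth [::] [:: [:: 1; 0; 0]; [:: 0; 0; 1]; [:: 0; 1; 0]]
                  (i - n.-1.*2)) (j - n.-1.*2).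

Lemma heis_gram_cast : exists e : (n.-1.*2 + 3 = n.*2.+1)%N,
  heis_gram n sigma = castmx (e, e)
    (block_mx (diag_mx (\row_(j < n.-1.*2) sigma j./2.+1)) 0 0 (heis_block R)).
Proof.
have e : (n.-1.*2 + 3 = n.*2.+1)%N.
  by case: n n_gt0 => // m _; rewrite doubleS addn3.
by exists e; rewrite /heis_gram -(conform_castmx (e, e)) conform_mx_id.
Qed.

Lemma heis_gramE (i j : 'I_n.*2.+1) : heis_gram n sigma i j = gram_entry i j.
Proof.
have [e ->] := heis_gram_cast; rewrite castmxE /gram_entry /=.
rewrite -[i : nat]/(cast_ord (esym e) i : nat).
rewrite -[j : nat]/(cast_ord (esym e) j : nat).
move: (cast_ord _ i) (cast_ord _ j) => {}i {}j; rewrite !mxE.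
case: (splitP i) => [i' ->|i' ->]; rewrite !mxE.
  case: (splitP j) => [j' ->|j' ->]; rewrite !mxE.
    by rewrite -val_eqE; case: eqP => _; rewrite ?mulr1n ?mulr0n.
  by rewrite (ltn_eqF (leq_trans (ltn_ord i') (leq_addr _ _))).
by case: (splitP j) => [j' ?|j' ->]; rewrite !mxE // !addKn.
Qed.

Lemma heis_phi_e a b : (a < n.*2.+1)%N -> (b < n.*2.+1)%N ->
  phi (heis_e R n a) (heis_e R n b) = gram_entry a b.
Proof.
have eE c (lt_c : (c < n.*2.+1)%N) : heis_e R n c = delta_mx 0 (Ordinal lt_c).
  by apply/rowP => i; rewrite !mxE eqxx.
move=> lt_a lt_b; rewrite !eE /heis_phi -rowE trmx_delta -colE !mxE.
exact: heis_gramE.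
Qed.

Lemma heis_phiC u w : phi u w = phi w u.
Proof.
have symG : (heis_gram n sigma)^T = heis_gram n sigma.
  apply/matrixP => i j; rewrite mxE !heis_gramE /gram_entry.
  have [-> //|/negPf ne_ij] := eqVneq i j.
  rewrite !val_eqE eq_sym ne_ij; case: ifP => _; case: ifP => _ //.
  move: (_ - _)%N (_ - _)%N => a b.
  by case: a b => [|[|[|a]]] [|[|[|b]]] //=; rewrite ?nth_nil.
rewrite /heis_phi -[LHS]/((fun M : 'M_1 => M 0 0) _).
have -> : u *m heis_gram n sigma *m w^T = (w *m heis_gram n sigma *m u^T)^T.
  by rewrite !trmx_mul trmxK symG mulmxA.
by rewrite mxE.
Qed.

Lemma heis_phi_linear u : linear_for *%R (phi u).
Proof.
by move=> a x y; rewrite /heis_phi linearD linearZ /= mulmxDr -scalemxAr !mxE.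
Qed.

Context (sigma_gt0 : forall k, (0 < k < n)%N -> 0 < sigma k).

Lemma heis_gram_unit : heis_gram n sigma \in unitmx.
Proof.
have castU p q (e : p = q) (A : 'M[R]_p) :
    (castmx (e, e) A \in unitmx) = (A \in unitmx) by case: q / e.
have [e ->] := heis_gram_cast; rewrite castU unitmxE det_ublock unitrM.
rewrite -!unitmxE; apply/andP; split.
  rewrite unitmxE det_diag unitfE prodf_seq_neq0; apply/allP => j _ /=.
  rewrite mxE gt_eqF // sigma_gt0 //=.
  by have := ltn_ord j; lia.
suff : heis_block R *m heis_block R = 1%:M by case/mulmx1_unit.
apply/matrixP => i j; rewrite !mxE !big_ord_recl big_ord0 !mxE /=.
by case: i j => [[|[|[|i]]] lt_i] [[|[|[|j]]] lt_j] //=;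
  rewrite ?(mulr0, mul0r, mulr1, addr0, add0r).
Qed.

Lemma heis_levi_civita_unique N1 N2 :
  is_levi_civita (@heis_bracket R n) phi N1 ->
  is_levi_civita (@heis_bracket R n) phi N2 -> forall u w, N1 u w = N2 u w.
Proof.
move=> [_ K1] [_ K2] u w; apply/(can_inj (mulmxK heis_gram_unit))/rowP => i.
have two_neq0 : (2 : R) != 0 by rewrite pnatr_eq0.
have := K1 u w (delta_mx 0 i); rewrite -K2 => /(mulfI two_neq0).
by rewrite /heis_phi trmx_delta -!colE !mxE.
Qed.

Lemma heis_levi_civita_exists :
  exists N, is_levi_civita (@heis_bracket R n) phi N.
Proof.
pose K u w x := phi (heis_bracket u w) x + phi (heis_bracket x u) w
  + phi (heis_bracket x w) u.
have [[/= brl brr] _ _] := heis_bracket_lie.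
have phir x (a : R) y y' : phi x (a *: y + y') = a * phi x y + phi x y'.
  by rewrite heis_phi_linear.
have phil x (a : R) y y' : phi (a *: y + y') x = a * phi y x + phi y' x.
  by rewrite heis_phiC phir !(heis_phiC x).
have Kl a y y' w x : K (a *: y + y') w x = a * K y w x + K y' w x.
  by rewrite /K brl brr !phil phir; ring.
have Km a y y' w x : K w (a *: y + y') x = a * K w y x + K w y' x.
  by rewrite /K !brr !phil phir; ring.
have Kr u w : linear_for *%R (K u w).
  by move=> a y y'; rewrite /K !brl !phil phir; ring.
pose row_K u w : heis R n := \row_j K u w (delta_mx 0 j).
exists (fun u w => 2^-1 *: (row_K u w *m invmx (heis_gram n sigma))).
split=> [|u w x].
  split=> w a u u' /=; rewrite scalerA mulrC -scalerA -scalerDr;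
    congr (_ *: _); rewrite scalemxAl -mulmxDl; congr (_ *m _);
    by apply/rowP => j; rewrite !mxE ?Kl ?Km.
have [KL KLE] : exists KL : {linear heis R n -> R | *%R}, KL =1 K u w.
  by exists (HB.pack_for {linear heis R n -> R | *%R} (K u w)
    (GRing.isLinear.Build _ _ _ _ _ (Kr u w))).
rewrite -[RHS]/(K u w x) -KLE /heis_phi -!scalemxAl mulmxKV ?heis_gram_unit //.
rewrite !mxE mulrA divff ?pnatr_eq0 // mul1r [in RHS](row_sum_delta x).
rewrite linear_sum; apply: eq_bigr => j _.
by rewrite linearZ /= KLE !mxE mulrC.
Qed.

Lemma heis_phi_ff k l : (0 < k <= n)%N -> (0 < l <= n)%N ->
  phi (f k) (f l) = if k == l then if (k < n)%N then sigma k else 1 else 0.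
Proof.
move=> hk hl; rewrite heis_phi_e /gram_entry ?doubleK ?prednK; try lia.
case: ifPn => h.
  have -> : (k.-1.*2 == l.-1.*2) = (k == l) by lia.
  by have -> : (k < n)%N by lia.
have -> : (k < n)%N = false by lia.
have -> : (k.-1.*2 - n.-1.*2 = 0)%N by lia.
case: ifPn => [h'|h']; first by have -> : (k == l) = false by lia.
have -> : (l.-1.*2 - n.-1.*2 = 0)%N by lia.
by have -> : k == l by lia.
Qed.

Lemma heis_phi_gg k l : (0 < k <= n)%N -> (0 < l <= n)%N ->
  phi (g k) (g l) = if (k == l) && (k < n)%N then sigma k else 0.
Proof.
move=> hk hl; rewrite heis_phi_e /gram_entry; try lia.
case: ifPn => h.
  have -> : (k.-1.*2.+1 == l.-1.*2.+1) = (k == l) by lia.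
  have -> : (k < n)%N by lia.
  by rewrite andbT /= uphalf_double prednK //; lia.
have -> : (k < n)%N = false by lia.
rewrite andbF; have -> : (k.-1.*2.+1 - n.-1.*2 = 1)%N by lia.
case: ifPn => [//|h']; by have -> : (l.-1.*2.+1 - n.-1.*2 = 1)%N by lia.
Qed.

Lemma heis_phi_fg k l : (0 < k <= n)%N -> (0 < l <= n)%N ->
  phi (f k) (g l) = 0.
Proof.
move=> hk hl; rewrite heis_phi_e /gram_entry; try lia.
case: ifPn => h; first by have -> : (k.-1.*2 == l.-1.*2.+1) = false by lia.
have -> : (k.-1.*2 - n.-1.*2 = 0)%N by lia.
case: ifPn => [//|h']; by have -> : (l.-1.*2.+1 - n.-1.*2 = 1)%N by lia.
Qed.

Lemma heis_phi_fz k : (0 < k <= n)%N -> phi (f k) z = 0.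
Proof.
move=> hk; rewrite heis_phi_e /gram_entry; try lia.
case: ifPn => h; first by have -> : (k.-1.*2 == n.*2) = false by lia.
have -> : (k.-1.*2 - n.-1.*2 = 0)%N by lia.
case: ifPn => [//|h']; by have -> : (n.*2 - n.-1.*2 = 2)%N by lia.
Qed.

Lemma heis_phi_gz k : (0 < k <= n)%N -> phi (g k) z = (k == n)%:R.
Proof.
move=> hk; rewrite heis_phi_e /gram_entry; try lia.
case: ifPn => h.
  have -> : (k.-1.*2.+1 == n.*2) = false by lia.
  by have -> : (k == n) = false by lia.
have -> : (k.-1.*2.+1 - n.-1.*2 = 1)%N by lia.
have -> : (n.*2 < n.-1.*2)%N = false by lia.
have -> : (n.*2 - n.-1.*2 = 2)%N by lia.
by have -> : k == n by lia.
Qed.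

Lemma heis_phi_zz : phi z z = 0.
Proof.
rewrite heis_phi_e /gram_entry; try lia.
have -> : (n.*2 < n.-1.*2)%N = false by lia.
by have -> : (n.*2 - n.-1.*2 = 2)%N by lia.
Qed.

Lemma heis_v_odd k : (0 < k < n)%N ->
  v k.*2.-1 = (1 / Num.sqrt (sigma k)) *: f k.
Proof.
case: k => // k hk; rewrite /heis_v !ifN_eq; try lia.
by rewrite doubleS /= odd_double /= doubleK.
Qed.

Lemma heis_v_even k : (0 < k < n)%N ->
  v k.*2 = (1 / Num.sqrt (sigma k)) *: g k.
Proof.
move=> hk; rewrite /heis_v !ifN_eq; try lia.
by rewrite odd_double /= uphalf_double.
Qed.

Lemma heis_v_f : v n.*2.-1 = f n.
Proof. by rewrite /heis_v eqxx !ifN_eq //; lia. Qed.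

Lemma heis_v_plus : v n.*2 = (1 / Num.sqrt 2) *: (g n + z).
Proof. by rewrite /heis_v eqxx ifN_eq //; lia. Qed.

Lemma heis_v_minus : v n.*2.+1 = (1 / Num.sqrt 2) *: (g n - z).
Proof. by rewrite /heis_v eqxx. Qed.

Lemma heis_v_orthonormal i j :
  (0 < i <= n.*2.+1)%N -> (0 < j <= n.*2.+1)%N ->
  phi (v i) (v j) = if i != j then 0 else if (i < n.*2.+1)%N then 1 else -1.
Proof.
have phiDr u w w' : phi u (w + w') = phi u w + phi u w'.
  by have := heis_phi_linear u 1 w w'; rewrite scale1r mul1r.
have phi0 u : phi u 0 = 0 by apply: (addIr (phi u 0)); rewrite -phiDr !add0r.
have phiZr u (a : R) w : phi u (a *: w) = a * phi u w.
  by have := heis_phi_linear u a w 0; rewrite phi0 !addr0.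
have phiNr u w : phi u (- w) = - phi u w by rewrite -scaleN1r phiZr mulN1r.
have phiDl u w w' : phi (w + w') u = phi w u + phi w' u.
  by rewrite !(heis_phiC _ u) phiDr.
have phiZl u (a : R) w : phi (a *: w) u = a * phi w u.
  by rewrite !(heis_phiC _ u) phiZr.
have phiNl u w : phi (- w) u = - phi w u by rewrite !(heis_phiC _ u) phiNr.
have phi_gf k l : (0 < k <= n)%N -> (0 < l <= n)%N -> phi (g k) (f l) = 0.
  by move=> *; rewrite heis_phiC heis_phi_fg.
have phi_zf k : (0 < k <= n)%N -> phi z (f k) = 0.
  by move=> *; rewrite heis_phiC heis_phi_fz.
have phi_zg k : (0 < k <= n)%N -> phi z (g k) = (k == n)%:R.
  by move=> *; rewrite heis_phiC heis_phi_gz.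
have s2 : (Num.sqrt 2)^-1 * (Num.sqrt 2)^-1 = 2^-1 :> R.
  by rewrite -invfM -expr2 sqr_sqrtr.
have ss k : (0 < k < n)%N ->
    (Num.sqrt (sigma k))^-1 * (Num.sqrt (sigma k))^-1 * sigma k = 1.
  move=> /sigma_gt0 k_gt0; rewrite -invfM -expr2 sqr_sqrtr ?ltW //.
  by rewrite mulVf ?gt_eqF.
have cases a : (0 < a <= n.*2.+1)%N ->
    [\/ exists2 k, (0 < k < n)%N & a = k.*2.-1,
        exists2 k, (0 < k < n)%N & a = k.*2
      | [\/ a = n.*2.-1, a = n.*2 | a = n.*2.+1]].
  move=> ha; have [hlt|hge] := ltnP a n.*2.-1.
    have := odd_double_half a; case: (odd a) => /= Ea.
      by apply: Or31; exists a./2.+1; lia.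
    by apply: Or32; exists a./2; lia.
  have [/eqP|?] := boolP (a == n.*2.-1); first by move=> ->; apply: Or33; apply: Or31.
  have [/eqP|?] := boolP (a == n.*2); first by move=> ->; apply: Or33; apply: Or32.
  by apply: Or33; apply: Or33; lia.
have nn : (0 < n <= n)%N by lia.
have wk k : (0 < k < n)%N -> (0 < k <= n)%N by lia.
have neqn k : (0 < k < n)%N -> (k == n) = false by lia.
have neqn' k : (0 < k < n)%N -> (n == k) = false by lia.
have phiE := (phiDl, phiDr, phiNl, phiNr, phiZl, phiZr).
have phiV := (heis_phi_ff, heis_phi_gg, heis_phi_fg, phi_gf, heis_phi_fz,
  heis_phi_gz, phi_zf, phi_zg, heis_phi_zz).
move=> /cases ci /cases cj.
case: ci => [[k hk ->]|[k hk ->]|[]->];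
case: cj => [[l hl ->]|[l hl ->]|[]->];
rewrite ?heis_v_f ?heis_v_plus ?heis_v_minus ?(heis_v_odd hk);
rewrite ?(heis_v_even hk) ?(heis_v_odd hl) ?(heis_v_even hl);
rewrite ?phiE ?phiV ?(wk _ hk) ?(wk _ hl) //;
rewrite ?(neqn _ hk) ?(neqn _ hl) ?(neqn' _ hk) ?(neqn' _ hl) ?eqxx ?ltnn ?andbF;
rewrite ?(mulr0, subr0, sub0r, addr0, add0r, oppr0, mulr1, mul1r, mulrN) /=;
try by rewrite ifT //; lia.
- have -> : (k.*2.-1 == l.*2.-1) = (k == l) by lia.
  have [<-|_] := eqVneq k l; last by rewrite !mulr0.
  by case/andP: (hk) => _ ->; rewrite mulrA ss ?ifT //; lia.
- have -> : (k.*2 == l.*2) = (k == l) by lia.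
  have [<-|_] := eqVneq k l; last by rewrite !mulr0.
  by case/andP: (hk) => _ ->; rewrite mulrA ss ?ifT //; lia.
- by rewrite ltnS leqnn mulrDr s2; lra.
- by rewrite addNr mulr0 ifT //; lia.
- by rewrite subrr mulr0 ifT //; lia.
- by rewrite mulrDr !mulrN s2; lra.
Qed.

End Basis.

(* Main.v *)
Require Import Defs.
From mathcomp Require Import all_boot all_order all_algebra.
From mathcomp Require Import reals ring lra zify.

Set Implicit Arguments.
Unset Strict Implicit.
Unset Printing Implicit Defensive.

Import Order.TTheory GRing.Theory Num.Theory.
Local Open Scope ring_scope.

(** The center of the Heisenberg algebra is spanned by [z], so its bracket is
    [[u, w] = omega(u, w) z] for a scalar alternating form [omega]. Writing
    [theta w] for [phi z w], the Koszul formula becomes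

      2 phi (nabla u w) t
        = omega(u, w) theta t + omega(t, u) theta w + omega(t, w) theta u.

    Let [J u] be the vector with [omega(t, u) = phi (J u) t] for all [t]. Since
    [phi] is nondegenerate, the displayed identity says that

      2 nabla u w = omega(u, w) z + theta w J u + theta u J w,

    and [omega(u, w)] is itself [phi (J w) u]; this is
    [levi_civita_symp_dual]. The connection is thus known once [J] and [theta]
    are known on the frame. Here [z = (v_{2n} - v_{2n+1}) / sqrt 2], so [theta]
    vanishes on [v_1, ..., v_{2n-1}] and is [1 / sqrt 2] on the last two
    vectors ([heis_phi_zv]), while [J] is
      [v_{2k-1} |-> - v_{2k} / sigma_k], [v_{2k} |-> v_{2k-1} / sigma_k],
      [v_{2n-1} |-> - z], and [v_{2n}, v_{2n+1} |-> v_{2n-1} / sqrt 2]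
    (the lemmas [symp_dual_v_*]). Every value of the connection now follows
    from the orthonormality of the frame.

    For the vanishing terms, any pair involving [v_{2n}] or [v_{2n+1}] is
    listed. On the remaining vectors [theta] is zero, so only
    [omega(v_a, v_b) z / 2] survives, and it vanishes unless
    [{a, b} = {2k-1, 2k}] for some [k < n]. *)

(** * Evaluation tactics *)

Ltac decide_index := repeat match goal with
  | |- context [@eq_op _ ?a ?b] =>
      first [have -> : (a == b) = true by lia
            |have -> : (a == b) = false by lia]
  | |- context [if leq ?a ?b then _ else _] =>
      first [have -> : leq a b = true by lia | have -> : leq a b = false by lia]
  end.

(** Evaluates [nabla] on two frame vectors. The argument [values] collects the
    products of the frame vectors with each other and with [z]; [zE] expands
    [z] in the frame and [sE] contracts [s * (s * x)], where
    [s = 1 / sqrt 2], which leaves an identity linear in the coordinates. *)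
Ltac nabla_eval nablaE values zE sE :=
  rewrite nablaE ?values; try lia; decide_index; rewrite ?zE /=;
  apply/rowP => j; rewrite !mxE ?(mulr1, mulrN, mulNr, sE); lra.

(** * The symplectic dual *)

Lemma heis_bracketC (R : realType) n (u w : heis R n) :
  heis_bracket u w = - heis_bracket w u.
Proof.
rewrite /heis_bracket -scaleNr; congr (_ *: _); rewrite -sumrN.
by apply: eq_bigr => k _; ring.
Qed.

Lemma heis_basis_ind (R : realType) n (P : heis R n -> Prop) :
    P 0 -> (forall (a : R) u w, P u -> P w -> P (a *: u + w)) ->
    (forall k, (0 < k <= n)%N -> P (heis_f R n k)) ->
    (forall k, (0 < k <= n)%N -> P (heis_g R n k)) -> P (heis_z R n) ->
  forall w, P w.
Proof.
move=> P0 Plin Pf Pg Pz w; rewrite (row_sum_delta w).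
elim/big_rec: _ => // i x _ Px; apply: Plin => //.
have -> : delta_mx 0 i = heis_e R n i.
  by apply/rowP => j; rewrite !mxE eqxx.
have lt_i := ltn_ord i; have [|ge_i] := ltnP i n.*2; last first.
  by have -> : (i : nat) = n.*2 by lia.
rewrite -{1 2}(odd_double_half i); case: (odd i) => lt_i2.
  by apply: (Pg (i./2).+1); lia.
by apply: (Pf (i./2).+1); lia.
Qed.

Section LeviCivita.
Context (R : realType) (n : nat) (sigma : nat -> R).
Context (n_gt0 : (0 < n)%N).
Context (sigma_gt0 : forall k, (0 < k < n)%N -> 0 < sigma k).

Local Notation phi := (@heis_phi R n sigma).
Local Notation br := (@heis_bracket R n).
Local Notation f := (heis_f R n).
Local Notation g := (heis_g R n).
Local Notation z := (heis_z R n).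
Local Notation v := (heis_v n sigma).

Let phiC u w : phi u w = phi w u.
Proof. exact: heis_phiC. Qed.

Lemma heis_phiDr u w w' : phi u (w + w') = phi u w + phi u w'.
Proof. by have := heis_phi_linear sigma u 1 w w'; rewrite scale1r mul1r. Qed.

Lemma heis_phi0r u : phi u 0 = 0.
Proof. by apply: (addIr (phi u 0)); rewrite -heis_phiDr !add0r. Qed.

Lemma heis_phiZr u (a : R) w : phi u (a *: w) = a * phi u w.
Proof. by have := heis_phi_linear sigma u a w 0; rewrite heis_phi0r !addr0. Qed.

Lemma heis_phiDl u w w' : phi (w + w') u = phi w u + phi w' u.
Proof. by rewrite !(phiC _ u) heis_phiDr. Qed.

Lemma heis_phiZl u (a : R) w : phi (a *: w) u = a * phi w u.
Proof. by rewrite !(phiC _ u) heis_phiZr. Qed.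

Lemma heis_phiNl u w : phi (- w) u = - phi w u.
Proof. by rewrite -scaleN1r heis_phiZl mulN1r. Qed.

Lemma heis_phi_nondegenerate x y : (forall w, phi x w = phi y w) -> x = y.
Proof.
move=> eq_xy; apply/(can_inj (mulmxK (heis_gram_unit n_gt0 sigma_gt0))).
apply/rowP => i; have := eq_xy (delta_mx 0 i).
by rewrite /heis_phi trmx_delta -!colE !mxE.
Qed.

(** In the notation used above, [x = J u]. The relational form spares the
    construction of [J] on all vectors, since only its values on the frame are
    needed. *)
Definition symp_dual u x := forall w, br w u = phi x w *: z.

Lemma symp_dual_basis u x :
    (forall k, (0 < k <= n)%N -> br (f k) u = phi x (f k) *: z) ->
    (forall k, (0 < k <= n)%N -> br (g k) u = phi x (g k) *: z) ->
    phi x z = 0 ->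
  symp_dual u x.
Proof.
move=> Df Dg Dz; have [[/= brl _] _ _] := @heis_bracket_lie R n.
apply: heis_basis_ind => //.
- rewrite heis_bracketC -(scale0r z) heis_bracket_z oppr0.
  by rewrite scale0r heis_phi0r scale0r.
- move=> a w w' Dw Dw'.
  by rewrite brl Dw Dw' heis_phiDr heis_phiZr scalerDl scalerA.
- by rewrite heis_bracketC -[z]scale1r heis_bracket_z oppr0 scale1r Dz scale0r.
Qed.

Lemma symp_dualZ a u x : symp_dual u x -> symp_dual (a *: u) (a *: x).
Proof.
move=> Dx w; have [[_ /= brr] _ _] := @heis_bracket_lie R n.
have br0 : br w 0 = 0 by rewrite -(scale0r z) heis_bracket_z scale0r.
by have := brr w a u 0; rewrite br0 !addr0 => ->; rewrite Dx heis_phiZl scalerA.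
Qed.

(** Central vectors pair to zero with everything under the bracket, so they
    do not change [J u]. *)
Lemma symp_dualDz a u x : symp_dual u x -> symp_dual (u + a *: z) x.
Proof.
move=> Dx w; have [[_ /= brr] _ _] := @heis_bracket_lie R n.
by have := brr w 1 u (a *: z); rewrite !scale1r heis_bracket_z addr0 Dx.
Qed.

Lemma symp_dual_f k : (0 < k < n)%N ->
  symp_dual (f k) (- (sigma k)^-1 *: g k).
Proof.
move=> hk; have hk' : (0 < k <= n)%N by lia.
have /lt0r_neq0 sk := sigma_gt0 hk.
apply: symp_dual_basis => [l hl|l hl|]; rewrite heis_phiZl.
- by rewrite heis_bracket_ff phiC heis_phi_fg // mulr0 scale0r.
- rewrite heis_bracketC heis_bracket_fg // heis_phi_gg //.
  have [_|_] /= := eqVneq k l; last by rewrite oppr0 mulr0 scale0r.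
  by rewrite ifT ?mulNr ?mulVf ?scaleN1r //; lia.
- by rewrite heis_phi_gz // ltn_eqF ?mulr0 //; lia.
Qed.

Lemma symp_dual_g k : (0 < k < n)%N -> symp_dual (g k) ((sigma k)^-1 *: f k).
Proof.
move=> hk; have hk' : (0 < k <= n)%N by lia.
have /lt0r_neq0 sk := sigma_gt0 hk.
apply: symp_dual_basis => [l hl|l hl|]; rewrite heis_phiZl.
- rewrite heis_bracket_fg // heis_phi_ff // eq_sym.
  have [_|_] := eqVneq k l; last by rewrite mulr0 scale0r.
  by rewrite ifT ?mulVf ?scale1r //; lia.
- by rewrite heis_bracket_gg heis_phi_fg // mulr0 scale0r.
- by rewrite heis_phi_fz // mulr0.
Qed.

Lemma symp_dual_fn : symp_dual (f n) (- z).
Proof.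
have hn : (0 < n <= n)%N by lia.
apply: symp_dual_basis => [l hl|l hl|]; rewrite heis_phiNl.
- by rewrite heis_bracket_ff phiC heis_phi_fz // oppr0 scale0r.
- rewrite heis_bracketC heis_bracket_fg // phiC heis_phi_gz // eq_sym.
  by case: eqP => _; rewrite ?scaleN1r // !oppr0 scale0r.
- by rewrite heis_phi_zz // oppr0.
Qed.

Lemma symp_dual_gn : symp_dual (g n) (f n).
Proof.
have hn : (0 < n <= n)%N by lia.
apply: symp_dual_basis => [l hl|l hl|].
- rewrite heis_bracket_fg // heis_phi_ff // eq_sym ltnn.
  by case: eqP => _; rewrite ?scale1r ?scale0r.
- by rewrite heis_bracket_gg heis_phi_fg // scale0r.
- by rewrite heis_phi_fz.
Qed.

(** Each of the three brackets in the Koszul formula is a multiple of [z] given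
    by a symplectic dual, so its right-hand side is a single product
    [phi _ t], and nondegeneracy removes [t]. *)
Lemma levi_civita_symp_dual nabla u w x y :
    is_levi_civita br phi nabla -> symp_dual u x -> symp_dual w y ->
  nabla u w = 2^-1 *: (phi y u *: z + phi z w *: x + phi z u *: y).
Proof.
move=> [_ koszul] Dx Dy; apply: heis_phi_nondegenerate => t.
have two_neq0 : (2 : R) != 0 by rewrite pnatr_eq0.
apply: (mulfI two_neq0); rewrite koszul Dx !Dy.
rewrite !(heis_phiDl, heis_phiZl) mulrA divff // mul1r.
by rewrite [_ * phi z w]mulrC [phi y t * _]mulrC.
Qed.

(** * The orthonormal frame *)

Lemma sqrt2V_sq : (Num.sqrt 2)^-1 * (Num.sqrt 2)^-1 = 2^-1 :> R.
Proof. by rewrite -invfM -expr2 sqr_sqrtr. Qed.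

Lemma heis_z_v : z = (Num.sqrt 2)^-1 *: (v n.*2 - v n.*2.+1).
Proof.
rewrite heis_v_plus // heis_v_minus -scalerBr scalerA mul1r sqrt2V_sq.
rewrite opprB [z - _]addrC addrACA subrr add0r scalerDr -scalerDl.
have -> : 2^-1 + 2^-1 = 1 :> R by lra.
by rewrite scale1r.
Qed.

(** The timelike vector [v_{2n+1}] is excluded on the left, so that no sign
    enters; its products are only met through [z]. *)
Lemma heis_phi_v i j : (0 < i <= n.*2)%N -> (0 < j <= n.*2.+1)%N ->
  phi (v i) (v j) = (i == j)%:R.
Proof.
move=> hi hj; rewrite heis_v_orthonormal //; last by lia.
by case: eqP => _ //=; rewrite ifT //; lia.
Qed.

Lemma heis_phi_zv i : (0 < i <= n.*2.+1)%N ->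
  phi z (v i) = if (i < n.*2)%N then 0 else (Num.sqrt 2)^-1.
Proof.
move=> hi; rewrite heis_z_v heis_phiZl heis_phiDl heis_phiNl.
rewrite heis_v_orthonormal //; last by lia.
rewrite heis_v_orthonormal //; last by lia.
have [hlt|[->|->]] : (i < n.*2)%N \/ i = n.*2 \/ i = n.*2.+1 by lia.
- by decide_index; rewrite /= subrr mulr0.
- by decide_index; rewrite /= subr0 mulr1.
- by decide_index; rewrite /= sub0r opprK mulr1.
Qed.

Lemma symp_dual_v_odd k : (0 < k < n)%N ->
  symp_dual (v k.*2.-1) (- (sigma k)^-1 *: v k.*2).
Proof.
move=> hk; have := symp_dualZ (1 / Num.sqrt (sigma k)) (symp_dual_f hk).
by rewrite heis_v_odd // heis_v_even // !scalerA [- _ * _]mulrC.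
Qed.

Lemma symp_dual_v_even k : (0 < k < n)%N ->
  symp_dual (v k.*2) ((sigma k)^-1 *: v k.*2.-1).
Proof.
move=> hk; have := symp_dualZ (1 / Num.sqrt (sigma k)) (symp_dual_g hk).
by rewrite heis_v_odd // heis_v_even // !scalerA [(sigma k)^-1 * _]mulrC.
Qed.

Lemma symp_dual_v_plus : symp_dual (v n.*2) ((Num.sqrt 2)^-1 *: v n.*2.-1).
Proof.
rewrite heis_v_plus // heis_v_f // div1r -[X in g n + X]scale1r.
by apply: symp_dualZ; apply: symp_dualDz; apply: symp_dual_gn.
Qed.

Lemma symp_dual_v_minus : symp_dual (v n.*2.+1) ((Num.sqrt 2)^-1 *: v n.*2.-1).
Proof.
rewrite heis_v_minus heis_v_f // div1r -scaleN1r.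
by apply: symp_dualZ; apply: symp_dualDz; apply: symp_dual_gn.
Qed.

Lemma symp_dual_v_f : symp_dual (v n.*2.-1) (- z).
Proof. by rewrite heis_v_f //; apply: symp_dual_fn. Qed.

End LeviCivita.

(** * Index pairs *)

Lemma heis_v_cases n a : (0 < a <= n.*2.+1)%N ->
  [\/ exists2 k, (0 < k < n)%N & a = k.*2.-1,
      exists2 k, (0 < k < n)%N & a = k.*2
    | [\/ a = n.*2.-1, a = n.*2 | a = n.*2.+1]].
Proof.
move=> ha; have [hlt|hge] := ltnP a n.*2.-1.
  have := odd_double_half a; case: (odd a) => /= Ea.
    by apply: Or31; exists a./2.+1; lia.
  by apply: Or32; exists a./2; lia.
apply: Or33; have [->|[->|->]] : a = n.*2.-1 \/ a = n.*2 \/ a = n.*2.+1 by lia.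
- exact: Or31.
- exact: Or32.
- exact: Or33.
Qed.

Lemma listed_pairs_diag n i : (0 < i <= n.*2.+1)%N -> (i, i) \in listed_pairs n.
Proof.
move=> hi; rewrite /listed_pairs mem_cat; apply/orP; left.
by apply/mapP; exists i => //; rewrite mem_iota; lia.
Qed.

Lemma listed_pairs_block n k p : (0 < k < n)%N ->
    p \in [:: (k.*2.-1, k.*2);    (k.*2, k.*2.-1);
              (k.*2.-1, n.*2);    (n.*2, k.*2.-1);
              (k.*2, n.*2);       (n.*2, k.*2);
              (k.*2.-1, n.*2.+1); (n.*2.+1, k.*2.-1);
              (k.*2, n.*2.+1);    (n.*2.+1, k.*2)] ->
  p \in listed_pairs n.
Proof.
move=> hk p_k; rewrite /listed_pairs !mem_cat.
apply/orP; right; apply/orP; left.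
by apply/flatten_mapP; exists k => //; rewrite mem_iota; lia.
Qed.

Lemma listed_pairs_last n p :
    p \in [:: (n.*2.-1, n.*2); (n.*2.-1, n.*2.+1);
              (n.*2, n.*2.-1); (n.*2.+1, n.*2.-1);
              (n.*2, n.*2.+1); (n.*2.+1, n.*2)] ->
  p \in listed_pairs n.
Proof. by move=> p_n; rewrite /listed_pairs !mem_cat p_n !orbT. Qed.

(** Every product with [v_{2n}] or [v_{2n+1}] is listed; these are the frame
    vectors on which [phi z] does not vanish. *)
Lemma listed_pairs_ge n a b : (0 < a <= n.*2.+1)%N -> (0 < b <= n.*2.+1)%N ->
  (n.*2 <= maxn a b)%N -> (a, b) \in listed_pairs n.
Proof.
have tl := @listed_pairs_last n; have tk := @listed_pairs_block n.
move=> ha hb; have diag := @listed_pairs_diag n.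
move: (heis_v_cases ha) (heis_v_cases hb).
case=> [[k hk ea]|[k hk ea]|[]ea]; case=> [[l hl eb]|[l hl eb]|[]eb] hmax;
  subst a b; try lia; try exact: diag;
  try by (apply: tl; rewrite !inE !eqxx ?orbT).
all: by apply: tk; [eassumption | rewrite !inE !eqxx ?orbT].
Qed.

(** * The Levi-Civita connection *)

Theorem theorem3p11 (R : realType) (n : nat) (sigma : nat -> R)
    (nabla : heis R n -> heis R n -> heis R n)
    (n_ge1 : (1 <= n)%N)
    (sigma_noninc : forall k : nat,
       (1 <= k)%N -> (k.+1 <= n.-1)%N -> sigma k.+1 <= sigma k)
    (sigma_ge1 : forall k : nat, (1 <= k <= n.-1)%N -> 1 <= sigma k)
    (nablaP : is_levi_civita (@heis_bracket R n) (@heis_phi R n sigma) nabla) :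
  let v := heis_v n sigma in
  (forall i : nat, (1 <= i <= n.*2.-1)%N -> nabla (v i) (v i) = 0) /\
  nabla (v n.*2) (v n.*2) = (1 / 2) *: v n.*2.-1 /\
  nabla (v n.*2.+1) (v n.*2.+1) = (1 / 2) *: v n.*2.-1 /\
  (forall k : nat, (1 <= k <= n.-1)%N ->
     let c := 1 / (2 * Num.sqrt 2 * sigma k) in
     nabla (v k.*2.-1) (v k.*2) = c *: v n.*2 - c *: v n.*2.+1 /\
     - nabla (v k.*2) (v k.*2.-1) = c *: v n.*2 - c *: v n.*2.+1 /\
     nabla (v k.*2.-1) (v n.*2) = (- c) *: v k.*2 /\
     nabla (v n.*2) (v k.*2.-1) = (- c) *: v k.*2 /\
     nabla (v k.*2) (v n.*2) = c *: v k.*2.-1 /\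
     nabla (v n.*2) (v k.*2) = c *: v k.*2.-1 /\
     nabla (v k.*2.-1) (v n.*2.+1) = (- c) *: v k.*2 /\
     nabla (v n.*2.+1) (v k.*2.-1) = (- c) *: v k.*2 /\
     nabla (v k.*2) (v n.*2.+1) = c *: v k.*2.-1 /\
     nabla (v n.*2.+1) (v k.*2) = c *: v k.*2.-1) /\
  nabla (v n.*2.-1) (v n.*2) = 0 /\
  nabla (v n.*2.-1) (v n.*2.+1) = 0 /\
  nabla (v n.*2) (v n.*2.-1) = (- 1 / 2) *: v n.*2 + (1 / 2) *: v n.*2.+1 /\
  nabla (v n.*2.+1) (v n.*2.-1) = (- 1 / 2) *: v n.*2 + (1 / 2) *: v n.*2.+1 /\
  nabla (v n.*2) (v n.*2.+1) = (1 / 2) *: v n.*2.-1 /\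
  nabla (v n.*2.+1) (v n.*2) = (1 / 2) *: v n.*2.-1 /\
  (forall a b : nat, (1 <= a <= n.*2.+1)%N -> (1 <= b <= n.*2.+1)%N ->
     (a, b) \notin listed_pairs n -> nabla (v a) (v b) = 0).
Proof.
move=> v.
have sigma_gt0 k : (0 < k < n)%N -> 0 < sigma k.
  by move=> hk; apply: lt_le_trans (sigma_ge1 k _); [exact: ltr01 | lia].
have Do := symp_dual_v_odd n_ge1 sigma_gt0.
have De := symp_dual_v_even n_ge1 sigma_gt0.
have Df := symp_dual_v_f sigma n_ge1.
have Dp := symp_dual_v_plus sigma n_ge1.
have Dm := symp_dual_v_minus sigma n_ge1.
have nablaE := levi_civita_symp_dual n_ge1 sigma_gt0 nablaP.
have phiE := (heis_phiZl sigma n_ge1, heis_phiNl sigma n_ge1).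
have phi_v := heis_phi_v n_ge1 sigma_gt0.
have phi_zv := heis_phi_zv n_ge1 sigma_gt0.
have zE := heis_z_v sigma n_ge1.
(* From here on the frame is opaque: only its products and duals are used. *)
rewrite -/v in Do De Df Dp Dm phi_v phi_zv zE; clearbody v.
set s : R := (Num.sqrt 2)^-1 in phi_zv zE Dp Dm.
have sE x : s * (s * x) = 2^-1 * x by rewrite mulrA sqrt2V_sq.
have cE x : 1 / (2 * Num.sqrt 2 * x) = 2^-1 * s * x^-1 by rewrite mul1r !invfM.
clearbody s.
have val := (phi_zv, phiE, phi_v).
split.
  move=> i hi; have [|[k hk ->]|[k hk ->]|[]E] := @heis_v_cases n i; try lia.
  - nabla_eval (nablaE _ _ _ _ (Do _ hk) (Do _ hk)) val zE sE.
  - nabla_eval (nablaE _ _ _ _ (De _ hk) (De _ hk)) val zE sE.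
  - rewrite E; nabla_eval (nablaE _ _ _ _ Df Df) val zE sE.
split; first by nabla_eval (nablaE _ _ _ _ Dp Dp) val zE sE.
split; first by nabla_eval (nablaE _ _ _ _ Dm Dm) val zE sE.
split.
  move=> k hk0; have hk : (0 < k < n)%N by lia.
  rewrite cE.
  move: (Do _ hk) (De _ hk) => Dk Dl.
  split; first by nabla_eval (nablaE _ _ _ _ Dk Dl) val zE sE.
  split; first by nabla_eval (nablaE _ _ _ _ Dl Dk) val zE sE.
  split; first by nabla_eval (nablaE _ _ _ _ Dk Dp) val zE sE.
  split; first by nabla_eval (nablaE _ _ _ _ Dp Dk) val zE sE.
  split; first by nabla_eval (nablaE _ _ _ _ Dl Dp) val zE sE.
  split; first by nabla_eval (nablaE _ _ _ _ Dp Dl) val zE sE.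
  split; first by nabla_eval (nablaE _ _ _ _ Dk Dm) val zE sE.
  split; first by nabla_eval (nablaE _ _ _ _ Dm Dk) val zE sE.
  split; first by nabla_eval (nablaE _ _ _ _ Dl Dm) val zE sE.
  by nabla_eval (nablaE _ _ _ _ Dm Dl) val zE sE.
split; first by nabla_eval (nablaE _ _ _ _ Df Dp) val zE sE.
split; first by nabla_eval (nablaE _ _ _ _ Df Dm) val zE sE.
split; first by nabla_eval (nablaE _ _ _ _ Dp Df) val zE sE.
split; first by nabla_eval (nablaE _ _ _ _ Dm Df) val zE sE.
split; first by nabla_eval (nablaE _ _ _ _ Dp Dm) val zE sE.
split; first by nabla_eval (nablaE _ _ _ _ Dm Dp) val zE sE.
move=> a b ha hb unlisted.
have hmax : (maxn a b < n.*2)%N.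
  by rewrite ltnNge; apply: contraNN unlisted; apply: listed_pairs_ge.
case: (heis_v_cases ha) unlisted hmax => [[k hk ->]|[k hk ->]|[]->];
  case: (heis_v_cases hb) => [[l hl ->]|[l hl ->]|[]->] unlisted hmax; try lia.
- by nabla_eval (nablaE _ _ _ _ (Do _ hk) (Do _ hl)) val zE sE.
- have ne_kl : k != l.
    apply: contraNneq unlisted => <-; apply: (listed_pairs_block hk).
    by rewrite !inE eqxx ?orbT.
  by nabla_eval (nablaE _ _ _ _ (Do _ hk) (De _ hl)) val zE sE.
- by nabla_eval (nablaE _ _ _ _ (Do _ hk) Df) val zE sE.
- have ne_kl : k != l.
    apply: contraNneq unlisted => <-; apply: (listed_pairs_block hk).
    by rewrite !inE eqxx ?orbT.
  by nabla_eval (nablaE _ _ _ _ (De _ hk) (Do _ hl)) val zE sE.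
- by nabla_eval (nablaE _ _ _ _ (De _ hk) (De _ hl)) val zE sE.
- by nabla_eval (nablaE _ _ _ _ (De _ hk) Df) val zE sE.
- by nabla_eval (nablaE _ _ _ _ Df (Do _ hl)) val zE sE.
- by nabla_eval (nablaE _ _ _ _ Df (De _ hl)) val zE sE.
- by nabla_eval (nablaE _ _ _ _ Df Df) val zE sE.
Qed.
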